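(* For every integer $n \geq 1$, let $B_n^{(3)}$ be the triangular book graph with vertex set $\{a, b, c_1, \dots, c_n\}$ and edge set $\{ab\} \cup \{ac_i, bc_i : 1 \leq i \leq n\}$ (order $n+2$, size $2n+1$). Then $$ms\left(B_n^{(3)}\right) = \begin{cases} 3, & \text{if } n = 1, \\ 4, & \text{if } n = 5, \\ \infty, & \text{if } n \equiv 0 \pmod 4, \\ \left\lceil \frac{n+1}{2} \right\rceil, & \text{otherwise.} \end{cases}$$
   Context: The triangular book graph $B_n^{(3)}$ consists of $n$ triangles sharing a common edge $ab$. Let $G$ be a graph of order $N$ with no component of order at most $2$. An edge $k$-labeling $f: E(G) \to \{1, 2, \dots, k\}$ is a modular irregular $k$-labeling of $G$ if the map $w_f: V(G) \to \mathbb{Z}_N$, $w_f(x) = \left(\sum_{xy \in E(G)} f(xy)\right) \bmod N$ (the modular weight of $x$), is a bijection onto $\mathbb{Z}_N$, the group of integers modulo $N$. The modular irregularity strength $ms(G)$ is the minimum $k$ for which $G$ admits a modular irregular $k$-labeling, and $ms(G) = \infty$ if $G$ admits no modular irregular labeling. *)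

(* Defs.v *)
From mathcomp Require Import all_boot.
From mathcomp Require Import boolp.

Set Implicit Arguments.
Unset Strict Implicit.
Unset Printing Implicit Defensive.

Record sgraph := SGraph {
  vertex : finType;
  edges : {set {set vertex}};
  edges_card : forall E, E \in edges -> #|E| = 2
}.

Section ModularIrregularity.
Variable G : sgraph.
Implicit Types (f : {set vertex G} -> nat) (k : nat).

Definition adj : rel (vertex G) := fun x y => [set x; y] \in edges G.

Definition no_small_component : Prop :=
  forall x, 2 < #|[set y | connect adj x y]|.

(* Only the values of [f] on edges matter, here and in the weights. *)
Definition edge_labeling k f : Prop :=
  forall E, E \in edges G -> 1 <= f E <= k.

Lemma order_gt0 (x : vertex G) : 0 < #|vertex G|.
Proof. by apply/card_gt0P; exists x. Qed.

(* Z_N is represented by its canonical residues 'I_N: unlike 'Z_N, this is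
   correct for every order N. *)
Definition modular_weight f (x : vertex G) : 'I_#|vertex G| :=
  Ordinal (ltn_pmod (\sum_(y | [set x; y] \in edges G) f [set x; y])
                    (order_gt0 x)).

Definition modular_irregular_labeling k f : Prop :=
  edge_labeling k f /\ bijective (modular_weight f).

Definition has_modular_irregular_labeling k : Prop :=
  exists f, modular_irregular_labeling k f.

(* [None] stands for infinity. *)
Definition ms : option nat :=
  match pselect (exists k, `[< has_modular_irregular_labeling k >]) with
  | left ex => Some (ex_minn ex)
  | right _ => None
  end.

End ModularIrregularity.

Section Book.
Variable n : nat.

Definition book_vertex : finType := (bool + 'I_n)%type.
Definition book_a : book_vertex := inl false.
Definition book_b : book_vertex := inl true.
Definition book_c (i : 'I_n) : book_vertex := inr i.

Definition book_edges : {set {set book_vertex}} :=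
  [set book_a; book_b]
    |: ([set [set book_a; book_c i] | i : 'I_n]
        :|: [set [set book_b; book_c i] | i : 'I_n]).

Lemma book_edges_card E : E \in book_edges -> #|E| = 2.
Proof.
by case/setU1P=> [->|/setUP[]/imsetP[i _ ->]]; rewrite cards2.
Qed.

Definition triangular_book : sgraph := SGraph book_edges_card.

Lemma card_book_vertex : #|vertex triangular_book| = n + 2.
Proof. by rewrite /= card_sum card_bool card_ord addnC. Qed.

Lemma card_book_edges : #|edges triangular_book| = 2 * n + 1.
Proof.
have neq (x y : bool) (i : 'I_n) :
    [set inl x; inl y] != [set inl x; inr i] :> {set book_vertex}.
  by apply/eqP => /setP/(_ (inr i)); rewrite !inE eqxx.
have inj (x : bool) : injective (fun i => [set inl x; inr i] : {set book_vertex}).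
  by move=> i j /setP/(_ (inr i)); rewrite !inE eqxx /= => /esym/eqP[].
rewrite /= cardsU1 cardsU !card_imset ?card_ord; [|exact: inj|exact: inj].
rewrite (_ : _ :&: _ = set0); last first.
  apply/setP=> E; rewrite !inE; apply/andP=> -[/imsetP[i _ ->] /imsetP[j _]].
  by move/setP/(_ book_a); rewrite !inE eqxx.
rewrite (_ : _ \notin _) ?cards0 ?subn0; first by rewrite addnC mul2n addnn.
rewrite inE negb_or; apply/andP; split; apply/imsetP=> -[i _ /eqP].
  by apply/negP/neq.
by rewrite setUC; apply/negP/neq.
Qed.

Lemma book_no_small_component : 0 < n -> no_small_component triangular_book.
Proof.
move=> n_gt0 x; pose i0 := Ordinal n_gt0.
have eab : [set book_a; book_b] \in book_edges by rewrite setU11.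
have eac i : [set book_a; book_c i] \in book_edges.
  by rewrite setU1r // inE; apply/orP; left; apply/imsetP; exists i.
have ebc i : [set book_b; book_c i] \in book_edges.
  by rewrite setU1r // inE; apply/orP; right; apply/imsetP; exists i.
have a_all (y : vertex triangular_book) : connect (@adj triangular_book) book_a y.
  by case: y => [[]|i]; rewrite ?connect0 //; apply: connect1; rewrite /adj.
have symc : connect_sym (@adj triangular_book).
  by apply: sym_connect_sym => u v; rewrite /adj setUC.
rewrite (_ : [set y | _] = setT); last first.
  apply/setP=> y; rewrite !inE; apply: connect_trans (a_all y).
  by rewrite symc.
by rewrite cardsT card_book_vertex addn2.
Qed.

End Book.

(* Main.v *)
Require Import Defs.
From mathcomp Require Import boolp.
From mathcomp Require Import all_boot.
From mathcomp Require Import zify.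

(** Label the edge [ab] by [e], and the edges [a c_i], [b c_i] by [x i], [y i].

    Lower bounds: the [n] sums [x i + y i] are distinct and lie in [2 .. 2k],
    so [n < 2k].  The sum of all weights is even, whereas [0 + ... + (n + 1)] is
    odd when [4] divides [n].  For [n = 5] and [k = 3] the sums [x i + y i]
    exhaust [2 .. 6], which confines the sums of the [x i] and of the [y i] to
    [8 .. 12]; no choice of [e] then gives weights [0] and [1] modulo [7].

    Constructions: let [x i + y i = i + 2] for [i < n], leaving the residues [0]
    and [1] to [a] and [b].  Choose [e] so that the total weight is right; then
    it suffices that [a] gets weight [0].  Subject to the bounds, the sum of the
    [x i] takes every value of an interval, and for [n >= 6] this interval meets
    every residue class modulo [n + 2]. *)

(** * Labelings of the book as triples of e, x and y *)

Section BookLabelings.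
Variable n : nat.

Definition book_weight (e : nat) (x y : 'I_n -> nat) (v : book_vertex n) : nat :=
  match v with
  | inl false => e + \sum_i x i
  | inl true => e + \sum_i y i
  | inr i => x i + y i
  end.

Lemma mem_book_edges (u v : book_vertex n) :
  ([set u; v] \in book_edges n) =
  match u, v with
  | inl p, inl q => p != q
  | inr _, inr _ => false
  | _, _ => true
  end.
Proof.
case: u => [p|i]; case: v => [q|j].
- case: (altP (p =P q)) => [->|neq].
    rewrite setUid; apply/negbTE/negP => /(@book_edges_card n).
    by rewrite cards1.
  rewrite !inE; apply/orP; left.
  by case: p q neq => [] [] //= _; rewrite // setUC.
- rewrite !inE; apply/orP; right; case: p; apply/orP; [right|left];
    by apply/imsetP; exists j.
- rewrite setUC !inE; apply/orP; right; case: q; apply/orP; [right|left];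
    by apply/imsetP; exists i.
- apply/negbTE/negP => /setU1P[|/setUP[]/imsetP[k _]] /setP.
  + by move/(_ (inl false)); rewrite !inE.
  + by move/(_ (inl false)); rewrite !inE.
  + by move/(_ (inl true)); rewrite !inE.
Qed.

Lemma sum_book_vertex (F : book_vertex n -> nat) :
  \sum_v F v = F (book_a n) + F (book_b n) + \sum_i F (book_c i).
Proof. by rewrite big_sumType /= big_bool /= [F _ + F _]addnC. Qed.

Lemma raw_weight_book (f : {set book_vertex n} -> nat) (v : book_vertex n) :
  \sum_(u | [set v; u] \in book_edges n) f [set v; u] =
  book_weight (f [set book_a n; book_b n])
    (fun i => f [set book_a n; book_c i])
    (fun i => f [set book_b n; book_c i]) v.
Proof.
rewrite big_mkcond sum_book_vertex /= !mem_book_edges.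
under eq_bigr => i _ do rewrite mem_book_edges.
case: v => [[]|i] /=; rewrite ?add0n ?addn0 //.
- by rewrite setUC.
- by rewrite big1 // addn0 !(setUC [set inr i]).
Qed.

Lemma has_book_labelingP k :
  has_modular_irregular_labeling (triangular_book n) k <->
  exists e (x y : 'I_n -> nat),
    [/\ 1 <= e <= k, forall i, 1 <= x i <= k, forall i, 1 <= y i <= k &
        injective (fun v => book_weight e x y v %% (n + 2))].
Proof.
have valw f v : val (modular_weight (G := triangular_book n) f v) =
    (\sum_(u | [set v; u] \in book_edges n) f [set v; u]) %% (n + 2).
  by rewrite /= card_book_vertex.
split=> [[f [lab /bij_inj injw]]|[e [x [y [he hx hy injw]]]]].
  exists (f [set book_a n; book_b n]), (fun i => f [set book_a n; book_c i]),
    (fun i => f [set book_b n; book_c i]).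
  split=> [|i|i|u v /= eq_uv]; try by apply: lab; rewrite /= mem_book_edges.
  by apply: injw; apply: val_inj; rewrite !valw !raw_weight_book.
(* An edge other than ab contains exactly one page vertex, so the picked [i] is forced; [inl false]
   is the vertex a. *)
pose f (E : {set book_vertex n}) :=
  if [pick i | inr i \in E] is Some i then
    if inl false \in E then x i else y i
  else e.
have fab : f [set book_a n; book_b n] = e.
  by rewrite /f; case: pickP => [i|//]; rewrite !inE.
have fac i : f [set book_a n; book_c i] = x i.
  rewrite /f; case: pickP => [j|/(_ i)]; last by rewrite !inE eqxx.
  by rewrite !inE => /eqP[->].
have fbc i : f [set book_b n; book_c i] = y i.
  rewrite /f; case: pickP => [j|/(_ i)]; last by rewrite !inE eqxx.
  by rewrite !inE => /eqP[->].
exists f; split=> [E|].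
  by case/setU1P=> [->|/setUP[]/imsetP[i _ ->]]; rewrite ?fab ?fac ?fbc.
apply: inj_card_bij; last by rewrite card_ord.
have facE : (fun i => f [set book_a n; book_c i]) = x by apply/funext.
have fbcE : (fun i => f [set book_b n; book_c i]) = y by apply/funext.
move=> u v /(congr1 val); rewrite !valw !raw_weight_book fab facE fbcE.
exact: injw.
Qed.

End BookLabelings.

Arguments book_weight {n}.

(** * Lower bounds and nonexistence *)

Lemma book_labeling_bound n k :
  has_modular_irregular_labeling (triangular_book n) k -> n <= 2 * k - 1.
Proof.
case/has_book_labelingP=> e [x [y [_ hx hy injw]]].
have s_lt i : x i + y i - 2 < 2 * k - 1 by have := hx i; have := hy i; lia.
have inj_s : injective (fun i => Ordinal (s_lt i)).
  move=> i j [eq_ij].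
  suff [] : inr i = inr j :> book_vertex n by [].
  apply: injw; congr (_ %% _) => /=.
  by have := hx i; have := hx j; have := hy i; have := hy j; lia.
by have := leq_card _ inj_s; rewrite !card_ord.
Qed.

(** Reduction modulo an even number preserves parity, so the residues reveal the parity of the total
    weight. *)
Lemma odd_sum_modn d I (r : seq I) (F : I -> nat) :
  ~~ odd d -> odd (\sum_(i <- r) F i %% d) = odd (\sum_(i <- r) F i).
Proof.
move=> evd; elim: r => [|i r IH]; rewrite ?big_nil // !big_cons !oddD IH.
by congr (_ (+) _); rewrite [in RHS](divn_eq (F i) d) oddD oddM (negbTE evd) andbF.
Qed.

Lemma no_book_labeling_4dvd n k :
  4 %| n -> ~ has_modular_irregular_labeling (triangular_book n) k.
Proof.
move=> n4 /has_book_labelingP[e [x [y [_ _ _ injw]]]].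
have lt_w v : book_weight e x y v %% (n + 2) < n + 2 by rewrite ltn_mod addn2.
pose g v := Ordinal (lt_w v).
have bij_g : bijective g.
  apply: inj_card_bij => [u v [/injw]//|].
  by rewrite card_ord (card_book_vertex n).
have sum_id : \sum_v book_weight e x y v %% (n + 2) = 'C(n + 2, 2).
  by rewrite -bin2_sum big_mkord (reindex g) //; apply: onW_bij.
have evn : ~~ odd (n + 2) by lia.
have := congr1 odd sum_id; rewrite odd_sum_modn // sum_book_vertex /= big_split /=.
(* For n = 4m this is (2m + 1)(4m + 1). *)
have : odd 'C(n + 2, 2).
  by case/dvdnP: n4 => m ->; rewrite bin2; lia.
by move=> ->; lia.
Qed.

(** The book is a triangle: two vertices share an edge, so their weights coincide when their other
    edges carry equal labels. Hence the three labels are distinct. *)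
Lemma book_labeling_1 k :
  has_modular_irregular_labeling (triangular_book 1) k -> 3 <= k.
Proof.
case/has_book_labelingP=> e [x [y [he hx hy injw]]].
rewrite leqNgt; apply/negP => ltk.
have hab : book_weight e x y (inl false) %% 3 <> book_weight e x y (inl true) %% 3.
  by move/injw.
have hac : book_weight e x y (inl false) %% 3 <> book_weight e x y (inr ord0) %% 3.
  by move/injw.
have hbc : book_weight e x y (inl true) %% 3 <> book_weight e x y (inr ord0) %% 3.
  by move/injw.
move: hab hac hbc; rewrite /= !big_ord1.
by have := hx ord0; have := hy ord0; lia.
Qed.

Lemma book_labeling_5 k :
  has_modular_irregular_labeling (triangular_book 5) k -> 4 <= k.
Proof.
case/has_book_labelingP=> e [x [y [he hx hy injw]]].
rewrite leqNgt; apply/negP => ltk.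
have s_lt i : x i + y i - 2 < 5 by have := hx i; have := hy i; lia.
pose g i := Ordinal (s_lt i).
have sE i : x i + y i = g i + 2 by rewrite /=; have := hx i; have := hy i; lia.
have bij_g : bijective g.
  apply: injF_bij => i j eq_ij.
  suff [] : inr i = inr j :> book_vertex 5 by [].
  by apply: injw; rewrite /= !sE eq_ij.
have sum_g (F : nat -> nat) : \sum_i F (g i) = F 0 + F 1 + F 2 + F 3 + F 4.
  have -> : \sum_i F (g i) = \sum_(j < 5) F j.
    by rewrite [RHS](reindex g) //; apply: onW_bij.
  by rewrite !big_ord_recr big_ord0.
(* The least value of a summand of [i + 2] when both summands lie in 1 .. 3. The five values are 1,
   1, 1, 2, 3, whence the 8. *)
pose lo i := maxn 1 (i + 2 - 3).
have le_x : 8 <= \sum_i x i.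
  rewrite -[8]/(lo 0 + lo 1 + lo 2 + lo 3 + lo 4) -sum_g; apply: leq_sum => i _.
  by have := sE i; have := hx i; have := hy i; rewrite /lo; lia.
have le_y : 8 <= \sum_i y i.
  rewrite -[8]/(lo 0 + lo 1 + lo 2 + lo 3 + lo 4) -sum_g; apply: leq_sum => i _.
  by have := sE i; have := hx i; have := hy i; rewrite /lo; lia.
have sum_xy : \sum_i x i + \sum_i y i = 20.
  rewrite -big_split /=; under eq_bigr => i _ do rewrite sE.
  exact: (sum_g (fun j => j + 2)).
have [h _ gh] := bij_g.
have notc b (j : 'I_5) : book_weight e x y (inl b) %% 7 <> (j + 2) %% 7.
  by rewrite -[in j + 2](gh j) -sE => /(@injw (inl b) (inr _)).
have hab : book_weight e x y (inl false) %% 7 <> book_weight e x y (inl true) %% 7.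
  by move/injw.
have res b : book_weight e x y (inl b) %% 7 <= 1.
  rewrite leqNgt; apply/negP => w_gt1.
  have lt_j : book_weight e x y (inl b) %% 7 - 2 < 5 by lia.
  by apply: (notc b (Ordinal lt_j)); rewrite /= subnK // modn_mod.
(* The residues of a and b are 0 and 1, so 2e + 20 = 1 modulo 7 and e = 1. Residue 0 then needs [X]
   or [Y] to be 6 modulo 7, but 8 .. 12 has no such number. *)
move: hab (res true) (res false) he => /=.
move: (\sum_i x i) (\sum_i y i) le_x le_y sum_xy => X Y; clear - ltk; lia.
Qed.

(** * Constructions *)

Lemma sum_intermediate n (lo hi : nat -> nat) t :
  (forall i, i < n -> lo i <= hi i) ->
  \sum_(i < n) lo i <= t <= \sum_(i < n) hi i ->
  exists2 x : nat -> nat,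
    forall i, i < n -> lo i <= x i <= hi i & \sum_(i < n) x i = t.
Proof.
elim: n t => [|n IH] t le_lohi.
  by rewrite !big_ord0 => ht; exists lo => //; rewrite big_ord0; lia.
rewrite !big_ord_recr /= => ht.
have le_n := le_lohi n (ltnSn n).
have le_lohi' i : i < n -> lo i <= hi i by move=> lt_in; apply: le_lohi; lia.
have le_sum : \sum_(i < n) lo i <= \sum_(i < n) hi i.
  by apply: leq_sum => i _; apply: le_lohi'.
have := IH _ le_lohi'; move: (\sum_(i < n) lo i) (\sum_(i < n) hi i) ht le_sum.
(* [z] is the least admissible last term that leaves at most [B] to the others. *)
move=> A B ht le_AB {}IH; pose z := maxn (lo n) (t - B).
have [|x hx sum_x] := IH (t - z); first by rewrite /z; lia.
exists (fun i => if i == n then z else x i) => [i lt_in|].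
  case: eqP => [->|ne]; first by rewrite /z; lia.
  by apply: hx; lia.
rewrite big_ord_recr /= eqxx -[RHS](@subnK z); last by rewrite /z; lia.
congr (_ + _); rewrite -sum_x; apply: eq_bigr => i _.
by case: eqP => // ei; have := ltn_ord i; lia.
Qed.

Lemma book_labeling_intro n k e (x y : nat -> nat) :
  1 <= e <= k ->
  (forall i, i < n -> [/\ 1 <= x i <= k, 1 <= y i <= k &
                         (x i + y i) %% (n + 2) = i + 2]) ->
  (e + \sum_(i < n) x i) %% (n + 2) = 0 ->
  (e + \sum_(i < n) y i) %% (n + 2) = 1 ->
  has_modular_irregular_labeling (triangular_book n) k.
Proof.
move=> he hxy ha hb; apply/has_book_labelingP.
exists e, (fun i => x i), (fun i => y i).
split=> // [i|i|u v]; try by case: (hxy i (ltn_ord i)).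
have hc (i : 'I_n) : (x i + y i) %% (n + 2) = i + 2 by case: (hxy i (ltn_ord i)).
case: u v => [[]|i] [[]|j] //=; rewrite ?ha ?hb ?hc; try lia.
by move=> eq_ij; congr inr; apply: val_inj => /=; lia.
Qed.

(** The bounds on x i say that both x i and y i = i + 2 - x i lie in 1 .. k; [n < 2 * k] makes them
    compatible. Here [t] is the sum of the x i. *)
Lemma book_labeling_of_interval n k e t :
  n < 2 * k -> 1 <= e <= k ->
  \sum_(i < n) maxn 1 (i + 2 - k) <= t <= \sum_(i < n) minn k i.+1 ->
  (e + t) %% (n + 2) = 0 ->
  (e + (\sum_(i < n) (i + 2) - t)) %% (n + 2) = 1 ->
  has_modular_irregular_labeling (triangular_book n) k.
Proof.
move=> ltnk he ht ha hb.
have [|//|x hx sum_x] :=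
  @sum_intermediate n (fun i => maxn 1 (i + 2 - k)) (fun i => minn k i.+1) t.
  by move=> i; lia.
apply: (@book_labeling_intro n k e x (fun i => i + 2 - x i)) => //.
- move=> i lt_in; have := hx i lt_in => hxi; split; try lia.
  by rewrite subnKC ?modn_small; lia.
- by rewrite sum_x.
- rewrite sumnB ?sum_x // => i _.
  by have := hx i (ltn_ord i); lia.
Qed.

Lemma sum_succ2 n : 2 * \sum_(i < n) (i + 2) = n * (n + 3).
Proof.
elim: n => [|n IH]; rewrite ?big_ord0 // big_ord_recr /=.
by move: (\sum_(i < n) _) IH => S; lia.
Qed.

(** The left side is the joint weight of a and b, which must be 0 + 1. The sum is -1 modulo n + 2
    for n = 2m + 1, so e = 1 works; it is 2m + 1 for n = 4m + 2, so e = m + 2 works. *)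
Lemma exists_book_edge_label n (k := uphalf n.+1) :
  1 < n -> ~~ (4 %| n) ->
  exists2 e, 1 <= e <= k & \sum_(i < n) (i + 2) + 2 * e = 1 %[mod n + 2].
Proof.
move=> n_gt1 n4; rewrite /k; have := sum_succ2 n; case: (boolP (odd n)) => n_odd.
  have -> : n = n./2.*2.+1 by lia.
  move: n./2 => m sum_n; exists 1; first by lia.
  rewrite (_ : _ + _ = m.+1 * (m.*2.+1 + 2) + 1) ?modnMDl //.
  by move: (\sum_(i < _) _) sum_n => S; lia.
have -> : n = 4 * (n %/ 4) + 2 by lia.
move: (n %/ 4) => m sum_n; exists (m + 2); first by lia.
rewrite (_ : _ + _ = (2 * m + 2) * (4 * m + 2 + 2) + 1) ?modnMDl //.
by move: (\sum_(i < _) _) sum_n => S; lia.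
Qed.

Lemma book_interval_length n k :
  5 < n -> n < 2 * k ->
  \sum_(i < n) maxn 1 (i + 2 - k) + n.+1 <= \sum_(i < n) minn k i.+1.
Proof.
move=> n_gt5 ltnk.
(* Here n = m + 6. The last term may have width 0, so the first n - 1 must provide the length: at
   least 8 for five terms, as k >= 4, and at least 1 for each further term. *)
have len m : m + 6 < 2 * k ->
    \sum_(i < m + 5) maxn 1 (i + 2 - k) + (m + 8) <= \sum_(i < m + 5) minn k i.+1.
  elim: m => [|m IH] ltmk; first by rewrite !big_ord_recr !big_ord0 /=; lia.
  have := IH ltac:(lia); rewrite addSn !big_ord_recr /=.
  by move: (\sum_(i < _) maxn _ _) (\sum_(i < _) minn _ _) => A B; lia.
have -> : n = (n - 6 + 5).+1 by lia.
have := len (n - 6) ltac:(lia); rewrite !big_ord_recr /=.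
by move: (\sum_(i < _) maxn _ _) (\sum_(i < _) minn _ _) => A B; lia.
Qed.

Lemma book_labeling_ge6 n :
  5 < n -> ~~ (4 %| n) ->
  has_modular_irregular_labeling (triangular_book n) (uphalf n.+1).
Proof.
move=> n_gt5 n4; set k := uphalf n.+1.
have ltnk : n < 2 * k by lia.
have [e he sum_e] := @exists_book_edge_label n (ltnW (ltnW (ltnW (ltnW n_gt5)))) n4.
have := @book_interval_length n k n_gt5 ltnk.
set L := \sum_(i < n) maxn _ _; set H := \sum_(i < n) minn _ _ => lenLH.
(* [e + t] is the largest multiple of n + 2 up to [e + L + n.+1], so [t] lies in L .. L + n + 1. *)
pose t := L + (n.+1 - (e + L + n.+1) %% (n + 2)).
have lt_r : (e + L + n.+1) %% (n + 2) < n + 2 by rewrite ltn_mod addn2.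
have et0 : (e + t) %% (n + 2) = 0.
  rewrite (_ : e + t = (e + L + n.+1) %/ (n + 2) * (n + 2)) ?modnMl //.
  by have := divn_eq (e + L + n.+1) (n + 2); rewrite /t; lia.
apply: (@book_labeling_of_interval n k e t) => //; first by rewrite /t; lia.
(* This keeps the truncated subtraction of [t] exact. *)
have le_H : H <= \sum_(i < n) (i + 2) by apply: leq_sum => i _; lia.
have le_t : t <= \sum_(i < n) (i + 2) by rewrite /t; lia.
have : (e + t) + (e + (\sum_(i < n) (i + 2) - t)) = 1 %[mod n + 2].
  by rewrite -sum_e; congr (_ %% _); lia.
by rewrite -modnDml et0 add0n [1 %% _]modn_small //; lia.
Qed.

(** * The value of the strength *)

Lemma ms_eq_Some G k :
  has_modular_irregular_labeling G k ->
  (forall j, has_modular_irregular_labeling G j -> k <= j) ->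
  ms G = Some k.
Proof.
move=> hk min_k; rewrite /ms; case: pselect => [ex|[]]; last by exists k; apply/asboolP.
congr Some; case: ex_minnP => m /asboolP hm min_m.
by apply/eqP; rewrite eqn_leq min_k // min_m //; apply/asboolP.
Qed.

Lemma ms_eq_None G :
  (forall k, ~ has_modular_irregular_labeling G k) -> ms G = None.
Proof.
by rewrite /ms => no; case: pselect => // ex; have [k /asboolP/no] := ex.
Qed.

Theorem theorem2 (n : nat) (hn : 1 <= n) :
  ms (triangular_book n) =
    if n == 1 then Some 3
    else if n == 5 then Some 4
    else if n == 0 %[mod 4] then None
    else Some (uphalf n.+1).
Proof.
case: eqP => [->|n1].
  apply: ms_eq_Some => [|j]; last exact: book_labeling_1.
  (* The page weight is 5, which is 2 only modulo 3: a sum equal to 2 would need x = y = 1. *)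
  apply: (@book_labeling_intro 1 3 1 (fun=> 2) (fun=> 3)) => //; rewrite ?big_ord1 //.
  by case.
case: eqP => [->|n5].
  apply: ms_eq_Some => [|j]; last exact: book_labeling_5.
  by apply: (@book_labeling_of_interval 5 4 1 6);
    rewrite // !big_ord_recr !big_ord0.
rewrite mod0n; case: (boolP (4 %| n)) => n4; rewrite /dvdn in n4 *.
  by rewrite n4; apply: ms_eq_None => k; apply: no_book_labeling_4dvd.
rewrite (negbTE n4); apply: ms_eq_Some => [|j /book_labeling_bound]; last by lia.
case: (ltnP 5 n) => [|le_n5]; first by move=> ?; exact: book_labeling_ge6.
(* The interval is now too short to meet every residue class; explicit values with e + t = n + 2
   do. *)
have [->|->] : n = 2 \/ n = 3 by move: n4; lia.
  by apply: (@book_labeling_of_interval 2 2 2 2);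
    rewrite // !big_ord_recr !big_ord0.
by apply: (@book_labeling_of_interval 3 2 1 4);
  rewrite // !big_ord_recr !big_ord0.
Qed.
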